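(* For every integer $p\ge 0$, \[\det[\chi_{i+j}(R)]_{i,j=0}^p=R^p\,\mathsf{sf}(p)\sum_{\sigma\in X_{p-1}}W_0(\sigma,R),\qquad \det[\chi_{i+j+2}(R)]_{i,j=0}^p=R^{p+1}\,\mathsf{sf}(p)\sum_{\sigma\in X_{p+1}}W_2(\sigma,R).\]
   Context: The reverse Bessel polynomials $\chi_i(R)\in\mathbb{Z}[R]$ are defined by $\chi_0=1$, $\chi_1=R$, $\chi_{i+2}=R^2\chi_i+(2i+1)\chi_{i+1}$. The superfactorial is $\mathsf{sf}(k)=\prod_{i=0}^k i!$. A Schröder path is a finite directed path in $\mathbb{Z}^2$ each of whose steps is an ascent $(x,y)\to(x+1,y+1)$, a descent $(x,y)\to(x+1,y-1)$, or a flat step $(x,y)\to(x+2,y)$ (the empty path is allowed). Let $P_i=(-i,i)$ and $Q_i=(i,i)$. For $k\ge 0$, $X_k$ is the set of collections of $k+1$ Schröder paths, pairwise vertex-disjoint, going from $\{P_i\}_{i=0}^k$ to $\{Q_i\}_{i=0}^k$; $X_{-1}$ consists only of the empty collection. The weight $W_0(\sigma,R)$ of a collection is the product over all steps of: $1$ for an ascent, $R$ for a flat step, $y+1$ for a descent starting at height $y$. The weight $W_2(\sigma,R)$ is the same product but with $y-1$ for a descent starting at height $y$. Empty products equal $1$. *)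

(* Defs.v *)
From HB Require Import structures.
From mathcomp Require Import all_boot all_order all_algebra.
Set Implicit Arguments. Unset Strict Implicit. Unset Printing Implicit Defensive.
Import Order.TTheory GRing.Theory Num.Theory.
Local Open Scope ring_scope.

(* Reverse Bessel polynomials chi_i in Z[R], R = 'X. *)
Fixpoint chi_pair (n : nat) : {poly int} * {poly int} :=
  match n with
  | 0%N => (1, 'X)
  | i.+1 => let (a, b) := chi_pair i in
            (b, 'X ^+ 2 * a + (2 * i + 1)%N%:R * b)
  end.
Definition chi (n : nat) : {poly int} := (chi_pair n).1.

Definition sf (k : nat) : nat := (\prod_(i < k.+1) i`!)%N.

Inductive step := Up | Dn | Fl.

Fixpoint verts (x y : int) (w : seq step) : seq (int * int) :=
  (x, y) :: match w with
            | [::] => [::]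
            | Up :: w' => verts (x + 1) (y + 1) w'
            | Dn :: w' => verts (x + 1) (y - 1) w'
            | Fl :: w' => verts (x + 2) y w'
            end.

Fixpoint endpt (x y : int) (w : seq step) : int * int :=
  match w with
  | [::] => (x, y)
  | Up :: w' => endpt (x + 1) (y + 1) w'
  | Dn :: w' => endpt (x + 1) (y - 1) w'
  | Fl :: w' => endpt (x + 2) y w'
  end.

Definition Ppt (i : nat) : int * int := (- (i%:Z), i%:Z).
Definition Qpt (i : nat) : int * int := (i%:Z, i%:Z).

Fixpoint words (n : nat) : seq (seq step) :=
  match n with
  | 0%N => [:: [::]]
  | n'.+1 => [seq s :: w | s <- [:: Up; Dn; Fl], w <- words n']
  end.
Definition words_le (N : nat) : seq (seq step) :=
  flatten [seq words n | n <- iota 0 N.+1].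

Fixpoint families (m N : nat) : seq (seq (seq step)) :=
  match m with
  | 0%N => [:: [::]]
  | m'.+1 => [seq w :: f | w <- words_le N, f <- families m' N]
  end.

Definition fverts (f : seq (seq step)) (i : nat) : seq (int * int) :=
  verts (Ppt i).1 (Ppt i).2 (nth [::] f i).
Definition fend (f : seq (seq step)) (i : nat) : int * int :=
  endpt (Ppt i).1 (Ppt i).2 (nth [::] f i).

Definition validX (m : nat) (f : seq (seq step)) : bool :=
  [&& size f == m,
      perm_eq [seq fend f i | i <- iota 0 m] [seq Qpt j | j <- iota 0 m] &
      all (fun i => all (fun j => (i < j)%N ==>
             ~~ has (fun v => v \in fverts f j) (fverts f i))
           (iota 0 m)) (iota 0 m)].

(* Xm m = X_{m-1}: collections of m paths. Any such path from P_i to Q_j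
   has at most i + j <= 2m steps, so the enumeration bound 2m loses nothing.
   Xm 0 = [:: [::]] is X_{-1} (only the empty collection). *)
Definition Xm (m : nat) : seq (seq (seq step)) :=
  [seq f <- families m (2 * m) | validX m f].

Fixpoint pweight (c : int) (y : int) (w : seq step) : {poly int} :=
  match w with
  | [::] => 1
  | Up :: w' => pweight c (y + 1) w'
  | Dn :: w' => (y + c)%:~R * pweight c (y - 1) w'
  | Fl :: w' => 'X * pweight c y w'
  end.

Definition Wt (c : int) (f : seq (seq step)) : {poly int} :=
  \prod_(i < size f) pweight c (Ppt i).2 (nth [::] f i).
Definition W0 (f : seq (seq step)) := Wt 1 f.
Definition W2 (f : seq (seq step)) := Wt (-1) f.

(* Main.v *)
Require Import Defs.
From HB Require Import structures.
From mathcomp Require Import all_boot all_order all_algebra.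
From mathcomp Require Import zify ring.
Import Order.TTheory GRing.Theory Num.Theory.
Local Open Scope ring_scope.

(** Let E be the shift of the sequence chi, and let p_0 = 1 and
    p_(y+1) = (E - R) p_y - y E p_(y-1).  As p_y is monic of degree y, replacing
    the rows of the Hankel matrix by the sequences Y_y = p_y(chi) preserves its
    determinant.  The definition of p_y reads
      Y_y(n+1) = Y_(y+1)(n) + y Y_(y-1)(n+1) + R Y_y(n),
    which is the first-step decomposition (ascent, descent, flat step) of weighted
    Schroeder paths starting at height y, with boundary values Y_y(0) = [y = 0] and
    Y_y(1) = R y!.  Up to a shift of the height by one, cutting such paths at their
    last point on the diagonal that carries the points Q_l factors the matrix
    (Y_y(n)) as the matrix of path sums from P_i to Q_l times a triangular matrix
    with diagonal entries R k!.  The determinant of path sums counts the disjoint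
    families by the Lindstroem-Gessel-Viennot lemma, and by planarity the only
    matching of sources and targets that occurs is the identity. *)

(** * Rows of the Hankel matrix *)

Lemma chiSS n : chi n.+2 = 'X ^+ 2 * chi n + (2 * n + 1)%:R * chi n.+1.
Proof. by rewrite /chi /=; case: (chi_pair n). Qed.

(* [bessel_row y n] is the n-th term of p_y(chi). *)
Fixpoint bessel_row (y n : nat) : {poly int} :=
  match y with
  | 0%N => chi n
  | y'.+1 => bessel_row y' n.+1 - 'X * bessel_row y' n
             - match y' with
               | 0%N => 0
               | y''.+1 => y'%:R * bessel_row y'' n.+1
               end
  end.

Lemma bessel_rowS y n : bessel_row y.+1 n =
  bessel_row y n.+1 - 'X * bessel_row y n - y%:R * bessel_row y.-1 n.+1.
Proof. by case: y => [|y] //=; rewrite mul0r. Qed.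

(* The chi recurrence, transported by the p_y: with the generating function
   Z(s, t) = sum Y_y(n) s^n/n! t^y/y! it is ((1-t)^2 - 2s) Z_ss = R^2 Z + Z_s, and
   the operator d_t + R - (1-t) d_s, which kills Z, also kills (1-t)^2 - 2s. *)
Lemma bessel_row_chiSS y n :
  bessel_row y n.+2 - (2 * y)%:R * bessel_row y.-1 n.+2
    + (y * y.-1)%:R * bessel_row y.-2 n.+2
  = 'X ^+ 2 * bessel_row y n + (2 * n + 1)%:R * bessel_row y n.+1.
Proof.
pose D z k := bessel_row z k.+2 - (2 * z)%:R * bessel_row z.-1 k.+2
    + (z * z.-1)%:R * bessel_row z.-2 k.+2
    - ('X ^+ 2 * bessel_row z k + (2 * k + 1)%:R * bessel_row z k.+1).
(* The defect [D] of the claimed identity obeys the recurrence that defines [bessel_row], so it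
   vanishes as soon as [D 0] does, and [D 0 = 0] is the recurrence of [chi]. *)
have DS z k : D z.+1 k = D z k.+1 - 'X * D z k - z%:R * D z.-1 k.+1.
  by rewrite /D; case: z => [|[|z]]; rewrite !bessel_rowS !succnK; ring.
apply/eqP; rewrite -subr_eq0 -/(D y n); apply/eqP.
elim/ltn_ind: y n => -[|y] IH n.
  by rewrite /D /= chiSS; ring.
rewrite DS !IH ?leqnn ?ltnS ?leq_pred //; ring.
Qed.

(** The value at 1 involves values at 2 only through U_z = Y_z(2) - z Y_(z-1)(2). At n = 0,
    [bessel_row_chiSS] becomes the first-order recurrence U_(z+1) = (z+1) U_z + R (z+1)!, whose
    solution is U_z = R (z+1)! + R^2 z!. *)
Lemma bessel_row_0_1 y :
  bessel_row y 0 = (y == 0%N)%:R /\ bessel_row y 1 = 'X * y`!%:R.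
Proof.
have fS z : (z.+1`!%:R : {poly int}) = z.+1%:R * z`!%:R by rewrite factS natrM.
elim/ltn_ind: y => -[|y] IH; first by rewrite /= mulr1.
have IH0 z : (z <= y)%N -> bessel_row z 0 = (z == 0%N)%:R.
  by rewrite -ltnS => /IH[].
have IH1 z : (z <= y)%N -> bessel_row z 1 = 'X * z`!%:R.
  by rewrite -ltnS => /IH[].
have IH2 z : (z <= y)%N -> bessel_row z 2 - z%:R * bessel_row z.-1 2
    = 'X * z.+1`!%:R + 'X ^+ 2 * z`!%:R.
  elim: z => [|z IHz] zy.
    have := bessel_row_chiSS 0 0.
    rewrite muln0 mul0n !mul0r !subr0 addr0 IH0 // IH1 // => ->.
    by rewrite (_ : 1`! = 1%N) // fact0 eqxx mulr1 mul1r mulr1 addrC.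
  have := bessel_row_chiSS z.+1 0; rewrite IH0 // IH1 // !succnK.
  have := IHz (ltnW zy) => Ez.
  rewrite (_ : bessel_row z.+1 2 - _ + _ =
    bessel_row z.+1 2 - z.+1%:R * bessel_row z 2
    - z.+1%:R * (bessel_row z 2 - z%:R * bessel_row z.-1 2)); last first.
    by ring.
  by rewrite Ez !fS => /eqP; rewrite subr_eq => /eqP -> /=; ring.
split; rewrite bessel_rowS.
  rewrite IH0 // IH1 //; case: y IH IH0 IH1 IH2 => [|y] IH IH0 IH1 IH2.
    by rewrite fact0 mul0r subr0 !mulr1 subrr.
  by rewrite succnK IH1 // fS /=; ring.
by rewrite IH1 // addrAC IH2 // fS; ring.
Qed.

(* Coefficients of p_y in powers of E. *)
Fixpoint row_coef (y k : nat) : {poly int} :=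
  match y with
  | 0%N => (k == 0%N)%:R
  | y'.+1 => (if k is k'.+1 then row_coef y' k' else 0) - 'X * row_coef y' k
             - match y' with
               | 0%N => 0
               | y''.+1 => y'%:R * (if k is k'.+1 then row_coef y'' k' else 0)
               end
  end.

Lemma row_coefS y k : row_coef y.+1 k =
  (if k is k'.+1 then row_coef y k' else 0) - 'X * row_coef y k
  - y%:R * (if k is k'.+1 then row_coef y.-1 k' else 0).
Proof. by case: y => [|y] //=; rewrite mul0r. Qed.

Lemma row_coef_triangular y :
  row_coef y y = 1 /\ forall k, (y < k)%N -> row_coef y k = 0.
Proof.
elim/ltn_ind: y => -[|y] IH; first by split=> // -[].
have [IHy IHgt] := IH y (ltnSn y).
split=> [|[|k] // ltyk]; rewrite row_coefS.
  rewrite IHy IHgt //; case: y IH {IHy IHgt} => [|y] IH.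
    by rewrite mulr0 mul0r !subr0.
  by rewrite succnK (IH y (leqW (ltnSn y))).2 // !mulr0 !subr0.
rewrite !IHgt ?(ltnW ltyk) // (IH y.-1 _).2 ?ltnS ?leq_pred //.
  by rewrite !mulr0 !subr0.
by apply: leq_ltn_trans (leq_pred y) _.
Qed.

Lemma bessel_row_sum N y n : (y < N)%N ->
  bessel_row y n = \sum_(k < N) row_coef y k * chi (k + n).
Proof.
elim/ltn_ind: y N n => -[|y] IH [//|N] n ltyN.
  rewrite big_ord_recl mul1r big1 ?addr0 // => i _.
  by rewrite /= mul0r.
under eq_bigr do rewrite row_coefS !mulrBl -!mulrA.
rewrite !sumrB bessel_rowS; congr (_ - _ - _).
- rewrite big_ord_recl mul0r add0r (IH y _ N) //.
  by apply: eq_bigr => i _; rewrite addSnnS.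
- by rewrite -mulr_sumr (IH y _ N.+1) // ltnW.
rewrite -mulr_sumr big_ord_recl mul0r add0r (IH y.-1 _ N) ?ltnS ?leq_pred //.
  by congr (_ * _); apply: eq_bigr => i _; rewrite addSnnS.
exact: leq_ltn_trans (leq_pred y) _.
Qed.

Lemma det_hankel_bessel_row p r :
  \det (\matrix_(i < p, j < p) chi (i + j + r)) =
  \det (\matrix_(i < p, j < p) bessel_row i (j + r)).
Proof.
pose L := \matrix_(i < p, j < p) row_coef i j.
have -> : \matrix_(i < p, j < p) bessel_row i (j + r) =
    L *m \matrix_(i < p, j < p) chi (i + j + r).
  apply/matrixP => i j; rewrite !mxE (bessel_row_sum p) //.
  by apply: eq_bigr => k _; rewrite !mxE addnA.
rewrite det_mulmx det_trig.
  by rewrite big1 ?mul1r // => i _; rewrite mxE (row_coef_triangular i).1.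
apply/is_trig_mxP => i j ltij; rewrite mxE.
exact: (row_coef_triangular i).2.
Qed.

(** * Sums over words and families *)

Definition move (v : int * int) (s : step) : int * int :=
  match s with
  | Up => (v.1 + 1, v.2 + 1)
  | Dn => (v.1 + 1, v.2 - 1)
  | Fl => (v.1 + 2, v.2)
  end.

Definition slen (s : step) : nat := if s is Fl then 2 else 1.

Definition extent (w : seq step) : nat := sumn (map slen w).

Lemma slen_gt0 s : (0 < slen s)%N. Proof. by case: s. Qed.

Lemma extent_cons s w : extent (s :: w) = (slen s + extent w)%N.
Proof. by []. Qed.

Definition sweight (c y : int) (s : step) : {poly int} :=
  match s with Up => 1 | Dn => (y + c)%:~R | Fl => 'X end.

Local Notation steps := [:: Up; Dn; Fl].
Local Notation pathv v w := (verts v.1 v.2 w).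
Local Notation pathe v w := (endpt v.1 v.2 w).

Lemma move_x (v : int * int) s : (move v s).1 = v.1 + (slen s)%:Z.
Proof. by case: s. Qed.

Lemma verts_cons v s w : pathv v (s :: w) = v :: pathv (move v s) w.
Proof. by case: v s => x y []. Qed.

Lemma endpt_cons v s w : pathe v (s :: w) = pathe (move v s) w.
Proof. by case: s. Qed.

Lemma pweight_cons c v s w :
  pweight c v.2 (s :: w) = sweight c v.2 s * pweight c (move v s).2 w.
Proof. by case: s => /=; rewrite ?mul1r. Qed.

Lemma endpt_x (v : int * int) w : (pathe v w).1 = v.1 + (extent w)%:Z.
Proof.
elim: w v => [|s w IH] v; first by rewrite /= addr0.
by rewrite endpt_cons IH move_x /extent /=; lia.
Qed.

Lemma mem_verts_head v w : v \in pathv v w.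
Proof. by case: v w => x y [|s w]; rewrite /= mem_head. Qed.

Lemma mem_verts (v : int * int) w (u : int * int) :
  u \in pathv v w -> u = v \/ w <> [::] /\ (v.1 < u.1)%R.
Proof.
elim: w v => [|s w IH] v.
  by rewrite inE => /eqP ->; left; case: v.
rewrite verts_cons inE => /orP[/eqP -> | /IH]; first by left.
have lts : v.1 < (move v s).1 by rewrite move_x; case: (s) => /=; lia.
by case=> [-> | [_ ltu]]; right; split=> //; lia.
Qed.

(* Sum of [g] over the words whose horizontal extent is at most [n]. *)
Fixpoint word_sum {V : nmodType} (n : nat) (g : seq step -> V) : V :=
  g [::] +
  match n with
  | 0%N => 0
  | n'.+1 => word_sum n' (fun w => g (Up :: w)) +
             word_sum n' (fun w => g (Dn :: w)) +
             match n' with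
             | 0%N => 0
             | n''.+1 => word_sum n'' (fun w => g (Fl :: w))
             end
  end.

Lemma word_sumE (V : nmodType) n (g : seq step -> V) : word_sum n g =
  g [::] + \sum_(s <- steps | (slen s <= n)%N)
             word_sum (n - slen s) (fun w => g (s :: w)).
Proof.
case: n => [|[|n]] /=; rewrite !big_cons big_nil //=.
  by rewrite !addr0.
by rewrite !subSS !subn0 addr0 !addrA.
Qed.

Lemma word_sum0 (V : nmodType) (g : seq step -> V) : word_sum 0 g = g [::].
Proof. exact: addr0. Qed.

Lemma eq_word_sum (V : nmodType) n (g h : seq step -> V) :
  (forall w, (extent w <= n)%N -> g w = h w) -> word_sum n g = word_sum n h.
Proof.
elim/ltn_ind: n g h => n IH g h gh; rewrite !word_sumE gh //; congr (_ + _).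
apply: eq_bigr => s len; apply: IH => [|w extw]; first by have := slen_gt0 s; lia.
by apply: gh; rewrite extent_cons; lia.
Qed.

Lemma word_sumD (V : nmodType) n (g h : seq step -> V) :
  word_sum n (fun w => g w + h w) = word_sum n g + word_sum n h.
Proof.
elim/ltn_ind: n g h => n IH g h; rewrite !word_sumE addrACA -big_split.
congr (_ + _); apply: eq_bigr => s len; apply: IH; by have := slen_gt0 s; lia.
Qed.

Lemma word_sum_const0 (V : nmodType) n : word_sum n (fun=> 0 : V) = 0.
Proof.
elim/ltn_ind: n => n IH; rewrite word_sumE add0r big1 // => s len.
by apply: IH; have := slen_gt0 s; lia.
Qed.

Lemma word_sum_sum (V : nmodType) n I (r : seq I) P (F : I -> seq step -> V) :
  word_sum n (fun w => \sum_(i <- r | P i) F i w) =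
  \sum_(i <- r | P i) word_sum n (F i).
Proof.
elim: r => [|i r IH].
  rewrite big_nil -[RHS](word_sum_const0 V n).
  by apply: eq_word_sum => w _; rewrite big_nil.
rewrite big_cons -IH; case: ifP => Pi.
  by rewrite -word_sumD; apply: eq_word_sum => w _; rewrite big_cons Pi.
by apply: eq_word_sum => w _; rewrite big_cons Pi.
Qed.

Lemma word_sumZ (V : pzSemiRingType) n (a : V) (g : seq step -> V) :
  word_sum n (fun w => a * g w) = a * word_sum n g.
Proof.
elim/ltn_ind: n g => n IH g; rewrite !word_sumE mulrDr mulr_sumr.
by congr (_ + _); apply: eq_bigr => s len; apply: IH; have := slen_gt0 s; lia.
Qed.

Lemma sum_words_leS (V : nmodType) N (g : seq step -> V) :
  \sum_(w <- words_le N.+1) g w =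
  g [::] + \sum_(s <- steps) \sum_(w <- words_le N) g (s :: w).
Proof.
have words_leE M (h : seq step -> V) : \sum_(w <- words_le M) h w =
    \sum_(0 <= n < M.+1) \sum_(w <- words n) h w.
  by rewrite /words_le big_flatten big_map /index_iota subn0.
rewrite words_leE big_nat_recl // big_seq1; congr (_ + _).
under [RHS]eq_bigr do rewrite words_leE.
rewrite exchange_big /=; apply: eq_bigr => n _.
by rewrite !big_cat !big_map !big_cons !big_nil.
Qed.

(** Each step has extent at least 1, so a word of extent at most [n] has at most [n] steps and
    already occurs in the enumeration by number of steps. *)
Lemma sum_words_le (V : nmodType) N n (g : seq step -> V) : (n <= N)%N ->
  (forall w, (n < extent w)%N -> g w = 0) ->
  \sum_(w <- words_le N) g w = word_sum n g.
Proof.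
elim: N n g => [|N IH] n g nN g0.
  move: nN; rewrite leqn0 => /eqP ->.
  by rewrite /words_le /= big_seq1 /= addr0.
rewrite sum_words_leS word_sumE; congr (_ + _).
rewrite [RHS]big_mkcond; apply: eq_bigr => s _.
case: ifP => len.
  apply: IH => [|w extw]; first by have := slen_gt0 s; lia.
  by apply: g0; rewrite extent_cons; lia.
rewrite big1 // => w _; apply: g0; rewrite extent_cons; lia.
Qed.

(* Sum of [F] over the families whose i-th word has extent at most [ns`_i]. *)
Fixpoint family_sum {V : nmodType} (ns : seq nat) (F : seq (seq step) -> V) : V :=
  if ns is n :: ns' then
    word_sum n (fun w => family_sum ns' (fun f => F (w :: f)))
  else F [::].

Lemma eq_family_sum (V : nmodType) ns (F G : seq (seq step) -> V) :
  (forall f, size f = size ns ->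
     (forall k, nth 0%N ns k = 0%N -> nth [::] f k = [::]) -> F f = G f) ->
  family_sum ns F = family_sum ns G.
Proof.
elim: ns F G => [|n ns IH] F G FG; first by apply: FG => // k; rewrite !nth_nil.
apply: eq_word_sum => w extw; apply: IH => f szf f0; apply: FG.
  by rewrite /= szf.
move=> [|k] /=; last exact: f0.
by move=> n0; move: extw; rewrite n0; case: w => // -[].
Qed.

Lemma family_sum_const0 (V : nmodType) ns : family_sum ns (fun=> 0 : V) = 0.
Proof.
elim: ns => //= n ns IH; rewrite -[RHS](word_sum_const0 V n).
exact: eq_word_sum.
Qed.

Lemma family_sumZ (V : pzSemiRingType) ns (a : V) F :
  family_sum ns (fun f => a * F f) = a * family_sum ns F.
Proof.
elim: ns F => //= n ns IH F; rewrite -word_sumZ.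
by apply: eq_word_sum => w _; rewrite -IH.
Qed.

Lemma family_sum_zeros (V : nmodType) ns (F : seq (seq step) -> V) :
  (forall k, nth 0%N ns k = 0%N) -> family_sum ns F = F (nseq (size ns) [::]).
Proof.
elim: ns F => //= n ns IH F ns0.
by rewrite (ns0 0%N : n = 0%N) word_sum0 IH // => k; apply: (ns0 k.+1).
Qed.

(** The i-th path is either empty, which the bound 0 enforces, or it has a first step [s], whose
    length is then deducted from its bound. *)
Lemma family_sum_expand (V : nmodType) ns i (F : seq (seq step) -> V) :
  (i < size ns)%N ->
  family_sum ns F = family_sum (set_nth 0%N ns i 0%N) F +
    \sum_(s <- steps | (slen s <= nth 0%N ns i)%N)
      family_sum (set_nth 0%N ns i (nth 0%N ns i - slen s)%N)
        (fun f => F (set_nth [::] f i (s :: nth [::] f i))).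
Proof.
elim: ns i F => //= n ns IH [|i] F ltin.
  by rewrite word_sumE /= addr0.
rewrite -word_sum_sum -word_sumD.
by apply: eq_word_sum => w _; rewrite (IH i).
Qed.

Lemma sum_families (V : nmodType) N ns (F : seq (seq step) -> V) :
  all (leq^~ N) ns ->
  (forall f i, size f = size ns -> (nth 0%N ns i < extent (nth [::] f i))%N ->
     F f = 0) ->
  \sum_(f <- families (size ns) N) F f = family_sum ns F.
Proof.
elim: ns F => [|n ns IH] F; first by rewrite big_seq1.
case/andP=> nN nsN F0.
rewrite [families _ _]/(allpairs_dep cons (words_le N)
  (fun=> families (size ns) N)) big_allpairs_dep.
rewrite (sum_words_le _ _ n) // => [|w extw].
  apply: eq_word_sum => w _; apply: IH => // f i szf exti.
  by apply: (F0 (w :: f) i.+1) => //=; rewrite szf.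
rewrite IH // => [|f i szf exti]; last first.
  by apply: (F0 (w :: f) i.+1) => //=; rewrite szf.
rewrite -[RHS](family_sum_const0 V ns); apply: eq_family_sum => f szf _.
by apply: (F0 (w :: f) 0%N) => //=; rewrite szf.
Qed.

(** * Vertex-disjoint families *)

Lemma nth_leq_sumn (s : seq nat) i : (nth 0%N s i <= sumn s)%N.
Proof.
elim: s i => [|x s IH] [|i] //=; first exact: leq_addr.
exact: leq_trans (IH i) (leq_addl _ _).
Qed.

Section LGV.

Variables (c : int) (m : nat) (t : nat -> int * int).
Implicit Types (vs : nat -> int * int) (ns : seq nat) (f : seq (seq step)).

Definition disjoint_paths vs f : bool :=
  [forall i : 'I_m, forall j : 'I_m, (i != j) ==>
    ~~ has (mem (pathv (vs j) (nth [::] f j))) (pathv (vs i) (nth [::] f i))].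

Definition family_weight vs f : {poly int} :=
  \prod_(i < m) pweight c (vs i).2 (nth [::] f i).

(** For distinct targets its determinant is the sign of the matching of sources with targets, and 0
    when the ends do not form a matching. *)
Definition end_matrix vs f : 'M[{poly int}]_m :=
  \matrix_(i < m, j < m) (pathe (vs i) (nth [::] f i) == t j)%:R.

Definition lgv_term vs f : {poly int} :=
  family_weight vs f * \det (end_matrix vs f) * (disjoint_paths vs f)%:R.

Definition path_matrix vs ns : 'M[{poly int}]_m :=
  \matrix_(i < m, j < m) word_sum (nth 0%N ns i)
     (fun w => pweight c (vs i).2 w * (pathe (vs i) w == t j)%:R).

Definition upd vs i u : nat -> int * int := fun k => if k == i then u else vs k.

(* All unexhausted sources may run up to abscissa [X]; an exhausted one lies at
   [X] already or has been stopped to the left of every unexhausted one. *)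
Definition consistent (X : int) vs ns : Prop := forall k, (k < m)%N ->
  (vs k).1 + (nth 0%N ns k)%:Z = X \/
  nth 0%N ns k = 0%N /\
    (forall j, (j < m)%N -> (0 < nth 0%N ns j)%N -> (vs k).1 <= (vs j).1).

Lemma disjoint_pathsP vs f :
  reflect (forall i j, (i < m)%N -> (j < m)%N -> i <> j ->
             forall u, u \in pathv (vs i) (nth [::] f i) ->
                       u \in pathv (vs j) (nth [::] f j) -> False)
          (disjoint_paths vs f).
Proof.
apply: (iffP forallP) => [H i j im jm ij u ui uj | H i].
  have /forallP /(_ (Ordinal jm)) := H (Ordinal im).
  have -> /= : Ordinal im != Ordinal jm by apply/eqP => -[].
  by move/hasPn => /(_ u ui) /negP; apply.
apply/forallP => j; apply/implyP => ij; apply/hasPn => u ui; apply/negP => uj.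
by apply: (H i j _ _ _ u) => //; apply/eqP.
Qed.

Lemma lgv_term_coincide vs f i j : (i < m)%N -> (j < m)%N -> i <> j ->
  vs i = vs j -> lgv_term vs f = 0.
Proof.
move=> im jm ij eij; rewrite /lgv_term.
case: disjoint_pathsP => [H|_]; last by rewrite mulr0.
case: (H i j im jm ij (vs i)); first exact: mem_verts_head.
by rewrite eij mem_verts_head.
Qed.

Lemma path_matrix_coincide vs ns (i j : 'I_m) : i <> j -> vs i = vs j ->
  nth 0%N ns i = nth 0%N ns j -> \det (path_matrix vs ns) = 0.
Proof.
move=> ij eij nij; apply: (determinant_alternate (i1 := i) (i2 := j)).
  exact/eqP.
by move=> k; rewrite !mxE eij nij.
Qed.

(** Counterpart of [family_sum_expand]: row [i] splits according to the first step, and the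
    cofactors along that row do not depend on it. *)
Lemma det_path_matrix_expand vs ns (i : 'I_m) :
  \det (path_matrix vs ns) =
  \det (path_matrix vs (set_nth 0%N ns i 0%N)) +
  \sum_(s <- steps | (slen s <= nth 0%N ns i)%N) sweight c (vs i).2 s *
    \det (path_matrix (upd vs i (move (vs i) s))
                      (set_nth 0%N ns i (nth 0%N ns i - slen s)%N)).
Proof.
have cof vs' ns' j : (forall k, k <> i :> nat -> vs' k = vs k) ->
    (forall k, k <> i :> nat -> nth 0%N ns' k = nth 0%N ns k) ->
    cofactor (path_matrix vs' ns') i j = cofactor (path_matrix vs ns) i j.
  move=> evs ens; rewrite /cofactor; congr (_ * \det _).
  apply/matrixP => a b; rewrite !mxE evs ?ens //;
    by move=> /val_inj /esym /eqP; rewrite (negbTE (neq_lift _ _)).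
rewrite !(expand_det_row _ i).
under [X in _ = _ + X]eq_bigr do rewrite (expand_det_row _ i) mulr_sumr.
rewrite exchange_big -big_split; apply: eq_bigr => j _.
have nths n k : nth 0%N (set_nth 0%N ns i n) k = if k == i then n else nth 0%N ns k.
  by rewrite nth_set_nth.
rewrite (cof vs (set_nth 0%N ns i 0%N)) // => [|k ki]; last first.
  by rewrite nths (introF eqP ki).
rewrite [in LHS]mxE [X in _ = X * _ + _]mxE nths eqxx word_sumE word_sum0 mulrDl.
congr (_ + _); rewrite mulr_suml; apply: eq_bigr => s len.
rewrite (cof (upd vs i _) (set_nth 0%N ns i _)) => [|k ki|k ki]; last 2 first.
- by rewrite /upd (introF eqP ki).
- by rewrite nths (introF eqP ki).
rewrite mxE [RHS]mulrA nths eqxx /upd eqxx -word_sumZ; congr (_ * _).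
by apply: eq_word_sum => w _; rewrite pweight_cons endpt_cons mulrA.
Qed.

(** No other path visits [vs i]: an empty path visits only its own source, and a nonempty one starts
    no further left and then moves strictly to the right. Hence putting [s] in front of path [i]
    does not affect disjointness. *)
Lemma lgv_term_step vs f i s : (i < m)%N ->
  (forall j, (j < m)%N -> i <> j -> vs j <> vs i) ->
  (forall j, (j < m)%N -> nth [::] f j <> [::] -> j <> i -> (vs i).1 <= (vs j).1) ->
  lgv_term vs (set_nth [::] f i (s :: nth [::] f i)) =
  sweight c (vs i).2 s * lgv_term (upd vs i (move (vs i) s)) f.
Proof.
move=> im neq_vs le_vs; set f' := set_nth _ _ _ _; set vs' := upd _ _ _.
have fi : nth [::] f' i = s :: nth [::] f i by rewrite nth_set_nth /= eqxx.
have fk k : k <> i -> nth [::] f' k = nth [::] f k.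
  by move=> ki; rewrite nth_set_nth /= (introF eqP ki).
have vi : vs' i = move (vs i) s by rewrite /vs' /upd eqxx.
have vk k : k <> i -> vs' k = vs k by move=> ki; rewrite /vs' /upd (introF eqP ki).
rewrite /lgv_term.
have -> : family_weight vs f' = sweight c (vs i).2 s * family_weight vs' f.
  rewrite /family_weight (bigD1 (Ordinal im)) //= [in RHS](bigD1 (Ordinal im)) //=.
  rewrite fi pweight_cons vi mulrA; congr (_ * _); apply: eq_bigr => k ki.
  by rewrite vk ?fk // => e; case/eqP: ki; apply: val_inj.
have -> : end_matrix vs f' = end_matrix vs' f.
  apply/matrixP => k j; rewrite !mxE.
  case: (eqVneq (k : nat) i) => [->|/eqP ki]; last by rewrite fk ?vk.
  by rewrite fi vi endpt_cons.
have -> : disjoint_paths vs f' = disjoint_paths vs' f.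
  have not_head j : (j < m)%N -> j <> i -> vs i \notin pathv (vs j) (nth [::] f j).
    move=> jm ji; apply/negP => /mem_verts [e|[fj lt_x]].
      by apply: (neq_vs j) => //; exact/nesym.
    by have := le_vs j jm fj ji; rewrite leNgt lt_x.
  apply/disjoint_pathsP/disjoint_pathsP => H a b am bm ab u.
    case: (eqVneq a i) (eqVneq b i) => [ai|/eqP ai] [bi|/eqP bi];
      first by case: ab; rewrite ai.
    - move: ab; rewrite ai vi vk // => ab ua ub; apply: (H i b _ _ _ u) => //.
        by rewrite fi verts_cons inE ua orbT.
      by rewrite fk.
    - move: ab; rewrite bi vi vk // => ab ua ub; apply: (H a i _ _ _ u) => //.
        by rewrite fk.
      by rewrite fi verts_cons inE ub orbT.
    - by rewrite !vk // => ua ub; apply: (H a b _ _ _ u); rewrite ?fk.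
  case: (eqVneq a i) (eqVneq b i) => [ai|/eqP ai] [bi|/eqP bi];
      first by case: ab; rewrite ai.
  - move: ab; rewrite ai fi fk // verts_cons inE => ab /orP[/eqP -> ub|ua ub].
      by move/negP: (not_head b bm bi); apply.
    by apply: (H i b _ _ _ u) => //; rewrite ?vi ?vk.
  - move: ab; rewrite bi fi fk // verts_cons inE => ab ua /orP[/eqP ub|ub].
      by move/negP: (not_head a am ai); apply; rewrite -ub.
    by apply: (H a i _ _ _ u) => //; rewrite ?vi ?vk.
  - by rewrite !fk // => ua ub; apply: (H a b _ _ _ u); rewrite ?vk.
by rewrite !mulrA.
Qed.

(* Replacing the leftmost active source by its successors expands the row of the
   path matrix, and no other path of a family can return to that source; when a
   successor is already a source, two rows coincide and no family is disjoint. *)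
Lemma lindstrom_gessel_viennot X vs ns : size ns = m -> consistent X vs ns ->
  (forall i j, (i < m)%N -> (j < m)%N -> vs i = vs j -> i = j) ->
  family_sum ns (lgv_term vs) = \det (path_matrix vs ns).
Proof.
have [N] := ubnP (sumn ns); elim: N vs ns => // N IH vs ns leN szn cons inj.
case: (boolP [exists i : 'I_m, (0 < nth 0%N ns i)%N]) => [/existsP[i0 i0P]|]; last first.
  move=> /existsPn ns0.
  have nz k : nth 0%N ns k = 0%N.
    case: (ltnP k m) => [km|mk]; last by rewrite nth_default ?szn.
    by have := ns0 (Ordinal km); rewrite -eqn0Ngt => /eqP.
  rewrite family_sum_zeros // /lgv_term.
  have -> : disjoint_paths vs (nseq (size ns) [::]).
    apply/disjoint_pathsP => i j im jm ij u; rewrite !nth_nseq !if_same.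
    rewrite !inE => /eqP -> /eqP e; apply: ij; apply: inj => //.
    by move: e; case: (vs i) (vs j) => [? ?] [? ?].
  rewrite mulr1 /family_weight big1 ?mul1r => [|i _]; last by rewrite nth_nseq if_same.
  congr (\det _); apply/matrixP => i j; rewrite !mxE nz word_sum0 nth_nseq if_same.
  by rewrite mul1r.
(* All active sources can run up to the same abscissa [X], so the one with the largest bound is a
   leftmost one. *)
pose i := [arg max_(k > i0) nth 0%N ns k].
have maxi (k : 'I_m) : (nth 0%N ns k <= nth 0%N ns i)%N.
  by rewrite /i; case: arg_maxnP => // j _; apply.
have ni_gt0 : (0 < nth 0%N ns i)%N := leq_trans i0P (maxi i0).
have Xi : (vs i).1 + (nth 0%N ns i)%:Z = X.
  by case: (cons i (ltn_ord i)) => // -[e]; move: ni_gt0; rewrite e.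
have min_i k : (k < m)%N -> (0 < nth 0%N ns k)%N -> (vs i).1 <= (vs k).1.
  move=> km nk; have := maxi (Ordinal km); case: (cons k km) => /= [|[e]]; last by lia.
  by move: Xi; lia.
have nths n k : nth 0%N (set_nth 0%N ns i n) k = if k == i then n else nth 0%N ns k.
  by rewrite nth_set_nth.
have szs n : size (set_nth 0%N ns i n) = m.
  by rewrite size_set_nth szn; apply/maxn_idPr.
have sums n : (n < nth 0%N ns i)%N -> (sumn (set_nth 0%N ns i n) < N)%N.
  move=> lt; rewrite sumn_set_nth_ltn ?szn //.
  by have := nth_leq_sumn ns i; lia.
rewrite (family_sum_expand _ _ i) ?szn // (det_path_matrix_expand _ _ i).
congr (_ + _).
  apply: IH => //; first exact: sums.
  move=> k km; rewrite nths; case: (eqVneq k i) => [->|ki].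
    right; split=> // j jm; rewrite nths; case: eqP => // _; exact: min_i.
  case: (cons k km) => [|[nk le_k]]; [by left | right; split=> // j jm].
  by rewrite nths; case: eqP => // _; apply: le_k.
apply: eq_bigr => s len; set n := (nth 0%N ns i - slen s)%N.
set vs' := upd vs i (move (vs i) s).
have lt_n : (n < nth 0%N ns i)%N by have := slen_gt0 s; rewrite /n; lia.
have -> : family_sum (set_nth 0%N ns i n)
    (fun f => lgv_term vs (set_nth [::] f i (s :: nth [::] f i))) =
    sweight c (vs i).2 s * family_sum (set_nth 0%N ns i n) (lgv_term vs').
  rewrite -family_sumZ; apply: eq_family_sum => f szf f0; apply: lgv_term_step => //.
    by move=> j jm ij /inj e; apply: ij; rewrite e.
  move=> j jm fj ji; apply: min_i => //; rewrite lt0n; apply/eqP => nj.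
  by apply: fj; apply: f0; rewrite nths (introF eqP ji).
congr (_ * _).
have vi : vs' i = move (vs i) s by rewrite /vs' /upd eqxx.
have vk k : k <> i :> nat -> vs' k = vs k by move=> ki; rewrite /vs' /upd (introF eqP ki).
case: (boolP [exists j : 'I_m, (j != i) && (vs j == move (vs i) s)]).
  case/existsP => j /andP[ji /eqP vj].
  have ij : i <> j by move=> e; case/eqP: ji.
  have ji' : j <> i :> nat by move=> /val_inj e; case/eqP: ji.
  (* Both rows must carry the same bound to be equal. The source [j] cannot have been stopped early,
     since it lies strictly to the right of the active source [i]; so it too runs up to [X]. *)
  have nj : nth 0%N ns j = n.
    have := cons j (ltn_ord j); rewrite vj move_x => -[|[nj /(_ i (ltn_ord i) ni_gt0)]].
      by rewrite /n; lia.
    by have := slen_gt0 s; lia.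
  rewrite (path_matrix_coincide vs' _ i j) //.
  - rewrite -[RHS](family_sum_const0 _ (set_nth 0%N ns i n)).
    apply: eq_family_sum => f _ _; apply: (lgv_term_coincide vs' f i j) => //.
      exact/nesym.
    by rewrite vi vk.
  - by rewrite vi vk.
  - by rewrite !nths eqxx (introF eqP ji') nj.
move=> /existsPn fresh; apply: IH => //; first exact: sums.
- move=> k km; rewrite nths; case: (eqVneq k i) => [->|/eqP ki].
    by left; rewrite vi move_x /n; lia.
  rewrite vk //; case: (cons k km) => [|[nk le_k]]; [by left | right; split=> // j jm].
  rewrite nths; case: (eqVneq j i) => [-> _|/eqP ji nj]; last by rewrite vk //; apply: le_k.
  by rewrite vi move_x; have := le_k i (ltn_ord i) ni_gt0; lia.
have notv k : (k < m)%N -> k <> i -> vs k <> move (vs i) s.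
  move=> km ki e; have := fresh (Ordinal km); rewrite /= e eqxx andbT => /negP; apply.
  by apply/eqP => e'; apply: ki; rewrite -e'.
move=> a b am bm; case: (eqVneq a i) (eqVneq b i) => [->|/eqP ai] [->|/eqP bi] //.
- by rewrite vi vk // => /esym /notv; case.
- by rewrite vi vk // => /notv; case.
by rewrite !vk //; apply: inj.
Qed.

End LGV.

(** * Planarity *)

Lemma move_sum (v : int * int) s : v.1 + v.2 <= (move v s).1 + (move v s).2.
Proof. by case: s => /=; lia. Qed.

Lemma move_diff (v : int * int) s : (move v s).2 - (move v s).1 <= v.2 - v.1.
Proof. by case: s => /=; lia. Qed.

Lemma endpt_sum (v : int * int) w : v.1 + v.2 <= (pathe v w).1 + (pathe v w).2.
Proof.
elim: w v => [|s w IH] v; first by rewrite /=; lia.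
by rewrite endpt_cons; have := IH (move v s); have := move_sum v s; lia.
Qed.

Lemma endpt_diff (v : int * int) w : (pathe v w).2 - (pathe v w).1 <= v.2 - v.1.
Proof.
elim: w v => [|s w IH] v; first by rewrite /=; lia.
by rewrite endpt_cons; have := IH (move v s); have := move_diff v s; lia.
Qed.

(* The first path stays below the second: the hypotheses say that the point lagging
   behind remains on its side of the other one even if it moves there by descents
   only (second path) or by ascents only (first path).  Moving the lagging point
   preserves this; the parity condition excludes crossings between vertices. *)
Lemma disjoint_endpts_lt (v1 v2 : int * int) w1 w2 (k : int) (l1 l2 : nat) :
  v1.1 + v1.2 = v2.1 + v2.2 + 2 * k ->
  (v2.1 <= v1.1 -> v1.1 + v1.2 <= v2.1 + v2.2) ->
  (v1.1 <= v2.1 -> v1.2 - v1.1 <= v2.2 - v2.1) ->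
  (forall u, u \in pathv v1 w1 -> u \in pathv v2 w2 -> False) ->
  pathe v1 w1 = Qpt l1 -> pathe v2 w2 = Qpt l2 -> (l1 < l2)%N.
Proof.
have [N] := ubnP (size w1 + size w2); elim: N v1 v2 w1 w2 k => // N IH.
move=> v1 v2 w1 w2 k szN par inv1 inv2 disj e1 e2.
have neq : v1.1 <> v2.1 \/ v1.2 <> v2.2.
  case: (eqVneq v1 v2) => [e|]; last first.
    case: (v1) (v2) => [x1 y1] [x2 y2] /=; rewrite xpair_eqE negb_and.
    by case/orP => /eqP; [left|right].
  by case: (disj v1); rewrite ?mem_verts_head // e mem_verts_head.
have d1 := endpt_diff v1 w1; have d2 := endpt_diff v2 w2.
have s1 := endpt_sum v1 w1; have s2 := endpt_sum v2 w2.
rewrite e1 /= in d1 s1; rewrite e2 /= in d2 s2.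
case: w1 => [|a1 w1] in szN disj e1 *; case: w2 => [|a2 w2] in szN disj e2 *.
- by move: e1 e2 => /= [] ? ? [] ? ?; lia.
(* The first path has ended on the diagonal y = x. The second path must still reach that diagonal
   and y - x never increases, so its next point is not below it. *)
- have d2' := endpt_diff (move v2 a2) w2; have s2' := endpt_sum (move v2 a2) w2.
  rewrite endpt_cons in e2; rewrite e2 /= in d2' s2'.
  move: (e1) => /= [] ? ?.
  (* A descent preserves x + y, and the other two steps raise it by 2; this dictates the new value
     of [k]. *)
  apply: (IH v1 (move v2 a2) [::] w2 (match a2 with Dn => k | _ => k - 1 end)) => //.
  + by case: a2 {disj e2 d2' s2' szN} => /=; lia.
  + by case: a2 {disj e2 szN} d2' s2' => /=; lia.
  + by case: a2 {disj e2 szN} d2' s2' => /=; lia.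
  + by move=> u u1 u2; apply: (disj u) => //; rewrite verts_cons inE u2 orbT.
- case: (lerP v1.1 v2.1) => le12; last first.
    by move: (e2) => /= [] ? ?; lia.
  apply: (IH (move v1 a1) v2 w1 [::] (match a1 with Dn => k | _ => k + 1 end)) => //.
  + by case: a1 {disj e1 szN} => /=; lia.
  + by case: a1 {disj e1 szN} => /=; lia.
  + by case: a1 {disj e1 szN} => /=; lia.
  + by move=> u u1 u2; apply: (disj u) => //; rewrite verts_cons inE u1 orbT.
  + by rewrite -e1 endpt_cons.
case: (lerP v1.1 v2.1) => le12.
  apply: (IH (move v1 a1) v2 w1 (a2 :: w2) (match a1 with Dn => k | _ => k + 1 end)) => //.
  + by case: a1 {disj e1 szN} => /=; lia.
  + by case: a1 {disj e1 szN} => /=; lia.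
  + by case: a1 {disj e1 szN} => /=; lia.
  + by move=> u u1 u2; apply: (disj u) => //; rewrite verts_cons inE u1 orbT.
  + by rewrite -e1 endpt_cons.
apply: (IH v1 (move v2 a2) (a1 :: w1) w2 (match a2 with Dn => k | _ => k - 1 end)) => //.
+ by move: szN => /=; lia.
+ by case: a2 {disj e2 szN} => /=; lia.
+ by case: a2 {disj e2 szN} => /=; lia.
+ by case: a2 {disj e2 szN} => /=; lia.
+ by move=> u u1 u2; apply: (disj u) => //; rewrite verts_cons inE u2 orbT.
+ by rewrite -e2 endpt_cons.
Qed.

Lemma validXE m f : size f = m ->
  validX m f = disjoint_paths m Ppt f &&
               perm_eq [seq fend f i | i <- iota 0 m] [seq Qpt j | j <- iota 0 m].
Proof.
move=> szf; rewrite /validX szf eqxx /= andbC; congr (_ && _).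
apply/allP/disjoint_pathsP => [H i j im jm ij u ui uj | H i].
  have Hlt a b : (a < b)%N -> (b < m)%N -> u \in fverts f a -> u \in fverts f b -> False.
    move=> ab bm ua ub; have /H /allP /(_ b) : a \in iota 0 m by rewrite mem_iota; lia.
    by rewrite mem_iota bm ab /= => /(_ isT) /hasPn /(_ u ua); rewrite ub.
  by case: (ltngtP i j) ij => // lt _; [apply: (Hlt i j) | apply: (Hlt j i)].
rewrite mem_iota => /= im; apply/allP => j; rewrite mem_iota => /= jm.
apply/implyP => ij; apply/hasPn => u ui; apply/negP => uj.
by apply: (H i j _ _ _ u) => //; lia.
Qed.

(** By [disjoint_endpts_lt] the ends increase strictly with the index of the source, and the only
    strictly increasing map from {0, ..., m-1} to itself is the identity. *)
Lemma disjoint_ends m f : disjoint_paths m Ppt f ->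
  (forall i, (i < m)%N -> exists2 j, (j < m)%N & fend f i = Qpt j) ->
  forall i, (i < m)%N -> fend f i = Qpt i.
Proof.
move=> /disjoint_pathsP disj ends.
pose ltx (u v : int * int) := (u.1 < v.1)%R.
have srtQ : sorted ltx [seq Qpt j | j <- iota 0 m].
  rewrite sorted_map; apply: sub_sorted (iota_ltn_sorted 0 m) => i j /=.
  by rewrite /ltx /=; lia.
have srtf : sorted ltx [seq fend f i | i <- iota 0 m].
  rewrite sorted_map.
  apply: (@sub_in_sorted _ (fun i => (i < m)%N) ltn); last exact: iota_ltn_sorted.
    move=> i j im jm ij; have [a am ea] := ends i im; have [b bm eb] := ends j jm.
    rewrite /relpre /ltx /= ea eb /=; suff : (a < b)%N by lia.
    apply: (disjoint_endpts_lt (Ppt i) (Ppt j) (nth [::] f i) (nth [::] f j) 0) => //.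
    - by rewrite /=; lia.
    - by rewrite /=; lia.
    - by rewrite /=; lia.
    by move=> u ui uj; apply: (disj i j im jm _ u) => // e; move: ij; rewrite e /= ltnn.
  by apply/allP => i; rewrite mem_iota.
have ltx_tr : transitive ltx by move=> a b d; rewrite /ltx; lia.
have ltx_irr : irreflexive ltx by move=> a; rewrite /ltx; lia.
have sub : {subset [seq fend f i | i <- iota 0 m] <= [seq Qpt j | j <- iota 0 m]}.
  move=> u /mapP[i]; rewrite mem_iota => /= im ->.
  have [j jm ->] := ends i im.
  by apply: map_f; rewrite mem_iota.
have uf := sorted_uniq ltx_tr ltx_irr srtf.
have [|_ eqm] := uniq_min_size uf sub; first by rewrite !size_map.
have eqs := irr_sorted_eq ltx_tr ltx_irr srtf srtQ eqm.
move=> i im; have := congr1 (nth (0, 0) ^~ i) eqs.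
by rewrite !(nth_map 0%N) ?size_iota // nth_iota.
Qed.

(** For disjoint paths ending at targets the matching is the identity, so the sign is 1; a path that
    ends at no target yields a zero row in [end_matrix]. *)
Lemma lgv_term_valid c m f : size f = m ->
  lgv_term c m Qpt Ppt f = if validX m f then Wt c f else 0.
Proof.
move=> szf; rewrite /lgv_term validXE //.
case: (boolP (disjoint_paths m Ppt f)) => [disj|_]; last by rewrite mulr0.
rewrite mulr1 andTb.
case: (boolP [forall i : 'I_m, [exists j : 'I_m, fend f i == Qpt j]]) => ends.
  have {}ends i : (i < m)%N -> fend f i = Qpt i.
    apply: disjoint_ends i => // i im.
    by move/forallP: ends => /(_ (Ordinal im)) /existsP[j /eqP]; exists j.
  rewrite (_ : [seq fend f i | i <- iota 0 m] = [seq Qpt j | j <- iota 0 m]); last first.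
    by apply/eq_in_map => i; rewrite mem_iota; apply: ends.
  rewrite perm_refl (_ : end_matrix _ _ _ _ = 1%:M) ?det1 ?mulr1.
    by rewrite /family_weight /Wt szf.
  apply/matrixP => i j; rewrite !mxE -/(fend f i) ends //.
  congr (nat_of_bool _)%:R; rewrite /Qpt xpair_eqE andbb.
  by apply/eqP/eqP => [[/val_inj]|->].
rewrite (_ : perm_eq _ _ = false); last first.
  apply/negP => /perm_mem eqm; move/negP: ends; apply; apply/forallP => i.
  have : fend f i \in [seq fend f i | i <- iota 0 m] by apply: map_f; rewrite mem_iota /=.
  rewrite eqm => /mapP[j]; rewrite mem_iota => /= jm ->.
  by apply/existsP; exists (Ordinal jm).
case/forallPn: ends => i /existsPn noend.
rewrite (expand_det_row _ i) big1 ?mulr0 // => j _.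
by rewrite mxE -/(fend f i) (negbTE (noend j)) mul0r.
Qed.

(** P_i has abscissa -i, so these bounds let every path run up to abscissa m, beyond all the
    targets. *)
Definition source_fuels (m : nat) : seq nat := mkseq (fun i => m + i)%N m.

Lemma nth_source_fuels m i : (i < m)%N -> nth 0%N (source_fuels m) i = (m + i)%N.
Proof. by move=> im; rewrite nth_mkseq. Qed.

Lemma sum_Xm c m :
  \sum_(f <- Xm m) Wt c f = \det (path_matrix c m Qpt Ppt (source_fuels m)).
Proof.
have szf : size (source_fuels m) = m by rewrite size_mkseq.
rewrite -(lindstrom_gessel_viennot c m Qpt m%:Z) //; first last.
- by move=> i j _ _ [].
- by move=> i im; left; rewrite nth_source_fuels //=; lia.
rewrite /Xm big_filter big_mkcond /=.
transitivity (family_sum (source_fuels m) (fun f => if validX m f then Wt c f else 0)).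
  rewrite -{1}szf; apply: sum_families.
    by apply/allP => n /mapP[i]; rewrite mem_iota => /= im ->; lia.
  rewrite szf => f i fm exti; case: ifP => //; rewrite validXE // => /andP[_ /perm_mem eqm].
  case: (ltnP i m) => im; last by move: exti; rewrite [nth [::] f i]nth_default ?fm.
  have : fend f i \in [seq fend f i | i <- iota 0 m] by apply: map_f; rewrite mem_iota.
  rewrite eqm => /mapP[j]; rewrite mem_iota => /= jm e.
  have := endpt_x (Ppt i) (nth [::] f i); rewrite -/(fend f i) e /=.
  by move: exti; rewrite nth_source_fuels //; lia.
by apply: eq_family_sum => f; rewrite szf => fm _; rewrite lgv_term_valid.
Qed.

(** * Triangular factorization *)

Section Factorization.

Variables (c : int) (M : nat).

Definition path_sum (v : int * int) (n l : nat) : {poly int} :=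
  word_sum n (fun w => pweight c v.2 w * (pathe v w == Qpt l)%:R).

Lemma path_sumE v n l : path_sum v n l = (v == Qpt l)%:R +
  \sum_(s <- steps | (slen s <= n)%N)
    sweight c v.2 s * path_sum (move v s) (n - slen s) l.
Proof.
rewrite /path_sum word_sumE; congr (_ + _); first by rewrite /= mul1r; case: v.
apply: eq_bigr => s _; rewrite -word_sumZ; apply: eq_word_sum => w _.
by rewrite pweight_cons endpt_cons mulrA.
Qed.

(** Along a path x + y never decreases and y - x never increases, while Q_l has x + y = 2l and y - x
    = 0. *)
Lemma path_sum_unreachable (v : int * int) n l :
  ~~ (v.1 + v.2 <= 2 * l%:Z) || (v.2 < v.1) -> path_sum v n l = 0.
Proof.
move=> H; rewrite -[RHS](word_sum_const0 _ n); apply: eq_word_sum => w _.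
case: eqP => [e|]; last by rewrite mulr0.
have := endpt_sum v w; have := endpt_diff v w; rewrite e /=.
by case/orP: H; lia.
Qed.

(** In the coordinates a = (x+y)/2, b = (y-x)/2 an ascent raises a by 1, a descent lowers b by 1 and
    a flat step does both; P_i is (0, i) and Q_l is (l, 0). For a at most [M] the bound lets paths
    run up to abscissa [M]. *)
Definition grid_sum (a b l : nat) : {poly int} :=
  path_sum (a%:Z - b%:Z, a%:Z + b%:Z) (M - a + b) l.

Lemma grid_sum_gt a b l : (l < a)%N -> grid_sum a b l = 0.
Proof. by move=> la; apply: path_sum_unreachable => /=; lia. Qed.

(** From the diagonal b = 0, descents and flat steps fall below every target, so only the path of
    ascents, of weight 1, contributes. *)
Lemma grid_sum0 a l : (l <= M)%N -> grid_sum a 0 l = (a <= l)%:R.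
Proof.
move=> lM; have [n] := ubnP (l.+1 - a); elim: n a => // n IH a lt_n.
case: (leqP a l) => al; last exact: grid_sum_gt.
rewrite /grid_sum path_sumE big_mkcond !big_cons big_nil /=.
rewrite [path_sum (_, _ - 1) _ _]path_sum_unreachable /=; last by lia.
rewrite [path_sum (_ + 2, _) _ _]path_sum_unreachable /=; last by lia.
rewrite !mulr0 !if_same !addr0 mul1r addn0.
case: (ltnP a l) => [ltal|].
  rewrite (_ : (_, _) == _ = false) ?add0r; last by rewrite /Qpt xpair_eqE; lia.
  rewrite ifT; last by lia.
  have := IH a.+1; rewrite ltal => <-; last by lia.
  by congr path_sum; [congr (_, _); lia | lia].
move=> la; have -> : a = l by lia.
rewrite path_sum_unreachable ?if_same /=; last by lia.
by rewrite addr0 (_ : (_, _) == _ = true) //; rewrite /Qpt xpair_eqE; lia.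
Qed.

Lemma grid_sumS a b l : (l <= M)%N ->
  grid_sum a b.+1 l = grid_sum a.+1 b.+1 l
    + ((a + b.+1)%N%:Z + c)%:~R * grid_sum a b l + 'X * grid_sum a.+1 b l.
Proof.
move=> lM; case: (leqP a M) => aM; last first.
  by rewrite !grid_sum_gt ?mulr0 ?addr0 //; lia.
rewrite {1}/grid_sum path_sumE big_mkcond !big_cons big_nil /=.
rewrite (_ : _ == _ = false) ?add0r; last by rewrite /Qpt xpair_eqE; lia.
rewrite addr0 mul1r addrA; congr (_ + _ + _).
- rewrite (_ : (1 <= _)%N) ; last by lia.
  (* At a = [M] the truncated subtraction makes the two bounds differ, but no target is reachable
     after the step, so both sides vanish. *)
  case: (eqVneq a M) => [ea|neaM].
    rewrite grid_sum_gt ?path_sum_unreachable //=; lia.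
  by congr path_sum; [congr (_, _); lia | lia].
- rewrite (_ : (1 <= _)%N) ; last by lia.
  rewrite PoszD; congr (_ * _).
  by congr path_sum; [congr (_, _); lia | lia].
case: (eqVneq a M) => [ea|neaM].
  rewrite grid_sum_gt ?path_sum_unreachable ?mulr0 ?if_same //=; lia.
rewrite (_ : (1 < _)%N) ; last by lia.
by congr (_ * path_sum _ _ _); [congr (_, _); lia | lia].
Qed.

Definition lattice_recurrence (g : nat -> nat -> {poly int}) : Prop :=
  forall a b, g a b.+1 = g a.+1 b.+1 + ((a + b.+1)%N%:Z + c)%:~R * g a b
                         + 'X * g a.+1 b.

(** Both sides satisfy the same recurrence and vanish for a >= m, so they agree once they agree at b
    = 0, where [grid_sum0] makes the right-hand side telescope. *)
Lemma lattice_recurrence_sum m (g : nat -> nat -> {poly int}) a b :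
  (m <= M)%N -> lattice_recurrence g -> (forall a b, (m <= a)%N -> g a b = 0) ->
  g a b = \sum_(l < m) grid_sum a b l * (g l 0%N - g l.+1 0%N).
Proof.
move=> mM rec g0; elim: b a => [|b IHb] a.
  have -> : \sum_(l < m) grid_sum a 0 l * (g l 0%N - g l.+1 0%N) =
      - \sum_(a <= l < m) (g l.+1 0%N - g l 0%N).
    rewrite big_geq_mkord [in RHS]big_mkcond -sumrN; apply: eq_bigr => l _.
    rewrite grid_sum0; last by have := ltn_ord l; lia.
    by case: leqP; rewrite ?mul1r ?mul0r ?opprB ?oppr0.
  case: (leqP m a) => [ma|am]; first by rewrite big_geq // oppr0 g0.
  by rewrite (telescope_sumr (fun l => g l 0%N)) ?(ltnW am) // (g0 m) // sub0r opprK.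
have [n] := ubnP (m - a); elim: n a => // n IHn a lt_n.
case: (leqP m a) => [ma|am].
  rewrite g0 // big1 // => l _; rewrite grid_sum_gt ?mul0r //.
  exact: leq_trans (ltn_ord l) ma.
rewrite rec (IHn a.+1) ?(IHb a) ?(IHb a.+1); last by lia.
rewrite !mulr_sumr -!big_split; apply: eq_bigr => l _ /=.
by rewrite (grid_sumS a); [ring | have := ltn_ord l; lia].
Qed.

(** Row i of the matrix sits at P_i. Since [g j] vanishes beyond a = j, the differences of its
    values at b = 0 form a triangular matrix with diagonal entries [g j j 0]. *)
Lemma det_lattice_recurrence m (g : nat -> nat -> nat -> {poly int}) : m = M ->
  (forall j, (j < m)%N -> lattice_recurrence (g j)) ->
  (forall j a b, (j < a)%N -> g j a b = 0) ->
  \det (\matrix_(i < m, j < m) g j 0%N i) =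
  \det (path_matrix c m Qpt Ppt (source_fuels m)) * \prod_(j < m) g j j 0%N.
Proof.
move=> mM rec g0.
pose U := \matrix_(l < m, j < m) (g j l 0%N - g j l.+1 0%N).
have -> : \matrix_(i < m, j < m) g j 0%N i =
    path_matrix c m Qpt Ppt (source_fuels m) *m U.
  apply/matrixP => i j; rewrite !mxE.
  rewrite (lattice_recurrence_sum m) ?mM //; last 2 first.
  - exact: rec.
  - by move=> a b ma; apply: g0; have := ltn_ord j; lia.
  apply: eq_bigr => l _; rewrite !mxE nth_source_fuels //; congr (_ * _).
  by rewrite /grid_sum /path_sum !sub0r !add0r subn0 -mM.
rewrite det_mulmx -[\det U]det_tr [\det U^T]det_trig.
  by congr (_ * _); apply: eq_bigr => j _; rewrite !mxE (g0 _ j.+1) ?subr0.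
by apply/is_trig_mxP => i j ij; rewrite !mxE !g0 ?subrr // ltnW.
Qed.

End Factorization.

(** * Evaluation of the two Hankel determinants *)

Lemma det_unit_first_col (R : comPzRingType) n (B : 'M[R]_n.+1) :
  (forall i, B i ord0 = (i == ord0)%:R) ->
  \det B = \det (\matrix_(i, j) B (lift ord0 i) (lift ord0 j)).
Proof.
move=> B0; rewrite (expand_det_col _ ord0) big_ord_recl big1 => [|i _].
  rewrite B0 eqxx mul1r addr0 /cofactor expr0 mul1r.
  by congr (\det _); apply/matrixP => i j; rewrite !mxE.
by rewrite B0 mul0r.
Qed.

Lemma det_hankel_0 p : \det (\matrix_(i < p.+1, j < p.+1) chi (i + j)) =
  'X ^+ p * (sf p)%:R * \sum_(s <- Xm p) W0 s.
Proof.
(* Rows are indexed by the height a + b plus one, to match the descent weight y + 1; raising a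
   consumes one term of the sequence. *)
pose g j a b := if (a <= j)%N then bessel_row (a + b).+1 (j - a).+1 else 0.
have rec j : lattice_recurrence 1 (g j).
  move=> a b; rewrite /g; case: (ltngtP a j) => [aj|ja|->].
  - rewrite !addnS !addSn (_ : (j - a)%N = (j - a.+1).+1); last by lia.
    by rewrite [bessel_row (a + b).+3 _]bessel_rowS succnK -PoszD addn1; ring.
  - by rewrite !mulr0 !addr0.
  (* On the edge a = j the terms replaced by 0 are values Y_y(0) with y > 0, which do vanish. *)
  rewrite subnn mulr0 addr0 add0r.
  have := bessel_rowS (j + b).+2 0; rewrite !(bessel_row_0_1 _).1 mulr0 subr0 succnK.
  by move/eqP; rewrite eq_sym subr_eq0 addnS -PoszD addn1 => /eqP ->.
have -> : \matrix_(i < p.+1, j < p.+1) chi (i + j) =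
    \matrix_(i < p.+1, j < p.+1) chi (i + j + 0).
  by apply/matrixP => i j; rewrite !mxE addn0.
rewrite det_hankel_bessel_row det_unit_first_col => [|i]; last first.
  by rewrite mxE (bessel_row_0_1 _).1.
have -> : \matrix_(i < p, j < p) (\matrix_(i0 < p.+1, j0 < p.+1)
      bessel_row i0 (j0 + 0)) (lift ord0 i) (lift ord0 j) =
    \matrix_(i < p, j < p) g j 0%N i.
  by apply/matrixP => i j; rewrite !mxE /g leq0n subn0 addn0 !lift0.
rewrite (det_lattice_recurrence 1 p) //; last first.
  by move=> j a b ja; rewrite /g leqNgt ja.
rewrite -sum_Xm mulrC; congr (_ * _).
transitivity (\prod_(j < p) ('X * (j.+1`!)%:R : {poly int})).
  by apply: eq_bigr => j _; rewrite /g leqnn addn0 subnn (bessel_row_0_1 _).2.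
rewrite big_split /= prodr_const card_ord; congr (_ * _).
(* The factor 0! = 1 of the superfactorial accounts for the shift of the index. *)
by rewrite /sf big_ord_recl mul1n natr_prod.
Qed.

(** Rows are now indexed by the height minus one, to match the descent weight y - 1. This leaves
    height 0 without a row, so the matrix is bordered by a row and by a unit column, which makes the
    collections consist of p + 2 paths. *)
Lemma det_hankel_2 p : \det (\matrix_(i < p.+1, j < p.+1) chi (i + j + 2)) =
  'X ^+ p.+1 * (sf p)%:R * \sum_(s <- Xm p.+2) W2 s.
Proof.
(* The source and target at the origin carry the column [j = 0]; the weight 0 of
   a descent from height 1 makes the values at (0, 0) irrelevant elsewhere. *)
pose g j a b := if j is 0%N then ((a + b)%N == 0%N)%:R else
  if (a <= j)%N && (0 < a + b)%N then bessel_row (a + b).-1 (j - a).+1 else 0.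
have rec j : lattice_recurrence (-1) (g j).
  move=> a b; rewrite /g addnS addSn; case: j => [|j].
    rewrite addnS /= mulr0 addr0 add0r; case: (a + b)%N => [|n]; rewrite ?mulr0 //.
    by rewrite subrr mul0r.
  have -> : ((a + b).+1%:Z + -1)%:~R = (a + b)%:R :> {poly int}.
    by rewrite -addn1 PoszD addrK.
  have wt n : (a + b)%:R * (if (0 < a + b)%N then bessel_row (a + b).-1 n else 0)
      = (a + b)%:R * bessel_row (a + b).-1 n.
    by case: posnP => // ->; rewrite !mul0r.
  rewrite !andbT addnS !succnK.
  case: (ltngtP a j.+1) => [aj|ja|eaj].
  - rewrite !andTb wt (_ : (j.+1 - a)%N = (j.+1 - a.+1).+1); last by lia.
    by rewrite bessel_rowS; ring.
  - by rewrite !andFb !mulr0 !addr0.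
  rewrite !andTb wt eaj subnn mulr0 addr0 add0r.
  have := bessel_rowS (j.+1 + b) 0; rewrite !(bessel_row_0_1 _).1 mulr0 subr0.
  by move/eqP; rewrite eq_sym subr_eq0 => /eqP ->.
rewrite det_hankel_bessel_row.
transitivity (\det (\matrix_(i < p.+2, j < p.+2) g j 0%N i)).
  rewrite [RHS]det_unit_first_col => [|i]; last by rewrite mxE.
  congr (\det _); apply/matrixP => i j; rewrite !mxE !lift0 /g.
  by rewrite add0n subn0 addn2.
rewrite (det_lattice_recurrence (-1) p.+2) //; last first.
  move=> [|j] a b ja; rewrite /g; first by case: a ja.
  by rewrite leqNgt ja.
rewrite -sum_Xm mulrC; congr (_ * _).
rewrite big_ord_recl mul1r.
transitivity (\prod_(j < p.+1) ('X * (j`!)%:R : {poly int})).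
  apply: eq_bigr => j _.
  by rewrite lift0 /g leqnn addn0 subnn /= (bessel_row_0_1 _).2.
by rewrite big_split /= prodr_const card_ord natr_prod.
Qed.

Theorem theorem6p1 (p : nat) :
  \det (\matrix_(i < p.+1, j < p.+1) chi (i + j)%N) =
    'X ^+ p * (sf p)%:R * \sum_(s <- Xm p) W0 s
  /\
  \det (\matrix_(i < p.+1, j < p.+1) chi (i + j + 2)%N) =
    'X ^+ p.+1 * (sf p)%:R * \sum_(s <- Xm p.+2) W2 s.
Proof. by split; [exact: det_hankel_0 | exact: det_hankel_2]. Qed.
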